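(* Let $P$ be an $n$-element inflated rooted forest poset. Then $P$ has at most $(n-1)!$ tangled labelings, with equality if and only if $P$ has a unique minimal element.
   Context: A labeling is a bijection $L:P\to[n]$; a linear extension is a labeling with $x<_P y\Rightarrow L(x)<L(y)$. Promotion $\partial$: for non-maximal $y$, the $L$-successor of $y$ is the element greater than $y$ with minimal label; the promotion chain is $v_1=L^{-1}(1)$, $v_{i+1}$ the $L$-successor of $v_i$, ending at the first maximal $v_m$; $\partial(L)(y)=L(y)-1$ off the chain, $\partial(L)(v_i)=L(v_{i+1})-1$ for $i<m$, $\partial(L)(v_m)=n$. The sorting time of $L$ is the least $k\ge0$ with $\partial^k(L)$ a linear extension; $L$ is tangled if its sorting time is $n-1$. A rooted forest poset is a poset in which each element is covered by at most one element. An inflation of a finite poset $Q$ is a poset $P$ with a surjection $\varphi:P\to Q$ such that each fiber $\varphi^{-1}(v)$ has a unique minimal element and, whenever $\varphi(x)\ne\varphi(y)$, $x<_P y$ iff $\varphi(x)<_Q\varphi(y)$. An inflated rooted forest poset is an inflation of a rooted forest poset. *)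

(* Defs.v *)
From HB Require Import structures.
From mathcomp Require Import all_boot all_order.
Set Implicit Arguments. Unset Strict Implicit. Unset Printing Implicit Defensive.
Import Order.TTheory.
Local Open Scope order_scope.

(* Conventions: a finite poset is a [finPOrderType d]; [<] is the strict order.
   Labels are 0-based: a labeling of an n-element poset P is a bijection
   P -> {0,...,n-1} (label k here corresponds to label k+1 in the paper). *)

Section Promotion.
Variables (d : Order.disp_t) (P : finPOrderType d).

Definition card_P := #|P|.

Definition lsucc (L : P -> nat) (y : P) : option P :=
  [pick z | (y < z) && [forall w, (y < w) ==> (L z <= L w)%N]].

Fixpoint chain_from (L : P -> nat) (k : nat) (y : P) : seq P :=
  match k with
  | 0 => [:: y]
  | k.+1 => y :: (match lsucc L y with Some z => chain_from L k z | None => [::] end)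
  end.

Definition promotion_chain (L : P -> nat) : seq P :=
  match [pick x | L x == 0%N] with
  | Some v1 => chain_from L #|P| v1
  | None => [::]
  end.

Definition promotion (L : P -> nat) : P -> nat := fun y =>
  if y \in promotion_chain L then
    match lsucc L y with
    | Some z => (L z).-1
    | None => #|P|.-1
    end
  else (L y).-1.

Definition is_linext (L : P -> nat) : bool :=
  [forall x : P, forall y : P, (x < y) ==> (L x < L y)%N].

Definition tangled_fun (L : P -> nat) : bool :=
  is_linext (iter #|P|.-1 promotion L) &&
  [forall k : 'I_#|P|.-1, ~~ is_linext (iter k promotion L)].

(* labelings: bijections P -> 'I_#|P| (injective suffices by cardinality) *)
Definition is_labeling (L : {ffun P -> 'I_#|P|}) : bool := injectiveb L.

Definition is_tangled_labeling (L : {ffun P -> 'I_#|P|}) : bool :=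
  is_labeling L && tangled_fun (fun x => nat_of_ord (L x)).

Definition tangled_labelings : {set {ffun P -> 'I_#|P|}} :=
  [set L | is_tangled_labeling L].

End Promotion.

Definition covers {d} {Q : finPOrderType d} (x y : Q) : Prop :=
  x < y /\ ~ (exists z, x < z /\ z < y).

Definition rooted_forest {d} (Q : finPOrderType d) : Prop :=
  forall x y1 y2 : Q, covers x y1 -> covers x y2 -> y1 = y2.

Definition is_inflation {d d'} (P : finPOrderType d) (Q : finPOrderType d')
  (phi : P -> Q) : Prop :=
  (forall v : Q, exists x, phi x = v) /\
  (forall v : Q, exists! m : P, phi m = v /\ forall x, phi x = v -> ~ (x < m)) /\
  (forall x y : P, phi x <> phi y -> (x < y <-> phi x < phi y)).

Definition inflated_rooted_forest {d} (P : finPOrderType d) : Prop :=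
  exists (d' : Order.disp_t) (Q : finPOrderType d') (phi : P -> Q),
    rooted_forest Q /\ is_inflation phi.

Definition unique_minimal {d} (P : finPOrderType d) : Prop :=
  exists! m : P, forall x : P, ~ (x < m).

(* Main.v *)
(* Spell a labeling as the word of the elements in order of their labels.
   Promotion is then a bubble-sort pass: the first letter is carried to the
   right, is exchanged with every greater letter it meets, and the letter carried
   last is put at the end. After k passes the last k letters form a sorted upper
   set, so L is tangled iff after n - 2 passes the word begins with y x where
   x < y. In that case x is a minimal element of P which had the largest label
   from the start and never moved; y is called the survivor.

   Fix a minimal x carrying the largest label. If S is the preimage of a down-set
   of the forest whose elements have the same upper bounds outside S, the
   positions of the letters of S evolve independently of which letters they are,
   up to exchanges inside a component. Hence, given that the survivor lies in S,
   it lies in a union C of components containing x with probability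
   (|C| - 1) / (|S| - 1). When S splits into parts C and C', these two
   probabilities add up to (|S| - 2) / (|S| - 1) < 1, and descending along the
   forest sums the contributions of all minimal elements x to at most (n - 1)!,
   with a strict loss as soon as a split occurs, that is, as soon as there are
   two minimal elements. *)
Require Import Defs.
From mathcomp Require Import all_boot all_order all_fingroup.
From mathcomp Require Import zify.
Set Implicit Arguments. Unset Strict Implicit. Unset Printing Implicit Defensive.
Import Order.POrderTheory.

(** * Bubble passes *)

Section Pass.
Variable T : eqType.
Implicit Types (r : rel T) (s u w : seq T).

Fixpoint pass r c s :=
  if s is z :: s' then if r c z then c :: pass r z s' else z :: pass r c s'
  else [:: c].

(** A pass interrupted at some position: the letter then in hand ([carry]) and the letters already
    written ([settled]), see [pass_cat]. *)
Fixpoint carry r c s :=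
  if s is z :: s' then carry r (if r c z then z else c) s' else c.

Fixpoint settled r c s :=
  if s is z :: s' then
    (if r c z then c else z) :: settled r (if r c z then z else c) s'
  else [::].

Definition step r w := if w is c :: s then pass r c s else [::].

Lemma pass_cat r c s u :
  pass r c (s ++ u) = settled r c s ++ pass r (carry r c s) u.
Proof. by elim: s c => //= z s IHs c; case: ifP; rewrite IHs. Qed.

Lemma size_settled r c s : size (settled r c s) = size s.
Proof. by elim: s c => //= z s IHs c; rewrite IHs. Qed.

Lemma perm_pass r c s : perm_eq (pass r c s) (c :: s).
Proof.
elim: s c => //= z s IHs c; case: ifP => _; first by rewrite perm_cons.
by apply: perm_trans (permEl (perm_catCA [:: z] [:: c] s)); rewrite perm_cons.
Qed.

Lemma perm_settled r c s : perm_eq (carry r c s :: settled r c s) (c :: s).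
Proof. by rewrite -perm_rcons -cats1 -(pass_cat r c s [::]) cats0 perm_pass. Qed.

Lemma perm_step r w : perm_eq (step r w) w.
Proof. by case: w => //= c s; apply: perm_pass. Qed.

Lemma perm_iter_step r w k : perm_eq (iter k (step r) w) w.
Proof. by elim: k => //= k; apply/perm_trans/perm_step. Qed.

Lemma mem_settled r c s : {subset settled r c s <= c :: s}.
Proof.
by move=> z zs; rewrite -(perm_mem (perm_settled r c s)) inE zs orbT.
Qed.

Lemma mem_carry r c s : carry r c s \in c :: s.
Proof. by rewrite -(perm_mem (perm_settled r c s)) mem_head. Qed.

Section Order.
Variable r : rel T.
Hypotheses (r_irr : irreflexive r) (r_trans : transitive r).

Lemma carry_ge c s : carry r c s = c \/ r c (carry r c s).
Proof.
elim: s c => [|z s IHs] c /=; first by left.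
by case: ifP => // cz; right; case: (IHs z) => [->|/(r_trans cz)].
Qed.

(** A letter is left behind in exchange for a greater one, or because it is not above the letter in
    hand; and the letter in hand only grows. *)
Lemma settled_not_above c s z : z \in settled r c s -> ~~ r (carry r c s) z.
Proof.
elim: s c => //= z0 s IHs c; rewrite inE; case: ifP => cz /predU1P [->|/IHs //].
  apply/negP => kc; have /negP := negbT (r_irr c); apply; move: kc.
  case: (carry_ge z0 s) => [->|zk kc]; first exact: r_trans.
  exact: r_trans cz (r_trans zk kc).
case: (carry_ge c s) => [->|ck]; first by rewrite cz.
by apply/negP => /(r_trans ck); rewrite cz.
Qed.

(** For [a] before [b] in a word: the pair is not inverted. A full word that is [pairwise not_above]
    spells a linear extension. *)
Definition not_above a b := ~~ r b a.

Lemma pass_sorted c s :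
  pairwise not_above (c :: s) -> pairwise not_above (pass r c s).
Proof.
elim: s c => //= z s IHs c /and3P [/andP [cz cs] zs ss].
case: ifP => [_|rcz] /=; rewrite IHs /= ?zs ?cs // andbT.
all: by rewrite (perm_all _ (perm_pass _ _ _)) /= ?cz ?zs ?cs ?andbT // /not_above rcz.
Qed.

Definition frozen m w :=
  allrel not_above (take m w) (drop m w) && pairwise not_above (drop m w).

Lemma frozen_pass m c s :
  m <= size s -> frozen m.+1 (c :: s) -> frozen m (pass r c s).
Proof.
move=> ms /andP [/= /allrelP A D].
rewrite -(cat_take_drop m s) pass_cat /frozen.
have sz : size (settled r c (take m s)) = m by rewrite size_settled size_takel.
rewrite take_size_cat // drop_size_cat //; apply/andP; split.
  apply/allrelP => a b aS; rewrite (perm_mem (perm_pass _ _ _)) inE.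
  case/predU1P => [->|bS]; first exact: settled_not_above.
  exact: A (mem_settled aS) bS.
apply: pass_sorted => /=; rewrite D andbT; apply/allP => b bS.
exact: A (mem_carry _ _ _) bS.
Qed.

Definition top x0 m w := all (fun a => ~~ r (nth x0 w m) a) (take m w).

(** Position [m] receives either the letter in hand, which is below no settled letter, or the next
    letter of [s] unchanged. *)
Lemma top_pass x0 m c s : m < size s ->
  (nth x0 (pass r c s) m = nth x0 s m \/ top x0 m (pass r c s)) /\
  (top x0 m.+1 (c :: s) -> top x0 m (pass r c s)).
Proof.
move=> ms; rewrite /top.
have sz : size (settled r c (take m s)) = m.
  by rewrite size_settled size_takel // ltnW.
have -> : take m (pass r c s) = settled r c (take m s).
  by rewrite -{1}(cat_take_drop m s) pass_cat take_size_cat.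
have -> : nth x0 (pass r c s) m =
    if r (carry r c (take m s)) (nth x0 s m) then carry r c (take m s)
    else nth x0 s m.
  rewrite -{1}(cat_take_drop m s) pass_cat nth_cat sz ltnn subnn.
  by rewrite (drop_nth x0) //=; case: ifP.
have H : all (fun a => ~~ r (carry r c (take m s)) a) (settled r c (take m s)).
  by apply/allP => a; apply: settled_not_above.
case: ifP => _; first by split=> [|_] //; right.
split; first by left.
move=> /allP A; apply/allP => a /mem_settled; exact: A.
Qed.

End Order.

(** With nothing below it, [x] is never picked up; the letter in hand goes past it. *)
Lemma index_pass r x c s : (forall a, ~~ r a x) -> c != x -> x \in s ->
  index x (pass r c s) = index x s.
Proof.
move=> rx; elim: s c => //= z s IHs c cx; rewrite inE eq_sym.
case: ifP => cz /=.
  have zx : z != x by apply: contraTneq cz => ->.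
  by rewrite (negPf cx) (negPf zx) /= => /IHs ->.
by case: eqP => //= _ /IHs ->.
Qed.

Lemma index_iter_step r x w k : (forall a, ~~ r a x) -> uniq w -> x \in w ->
  k <= index x w -> index x (iter k (step r) w) = index x w - k.
Proof.
move=> rx Uw xw; elim: k => [|k IHk] k_lt; first by rewrite subn0.
rewrite iterS; have {IHk} := IHk (ltnW k_lt).
have := perm_mem (perm_iter_step r w k) x; rewrite xw.
case: (iter _ _ _) => [|c s] //=; rewrite inE eq_sym; case: eqP => [_ _|/eqP cx /= xs].
  by lia.
by rewrite index_pass // => H; lia.
Qed.

(** [t] sorts letters into classes. The relations may disagree only on two letters of one class,
    whose exchange is invisible to [t]. *)
Lemma map_pass (K : Type) (t : T -> K) r r' c c' s s' :
  (forall a b a' b', t a = t a' -> t b = t b' ->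
     r a b = r' a' b' \/ t a = t b) ->
  t c = t c' -> map t s = map t s' ->
  map t (pass r c s) = map t (pass r' c' s').
Proof.
move=> rr'; elim: s s' c c' => [|z s IHs] [|z' s'] //= c c' tc => [_|[tz ts]].
  by rewrite tc.
case: (rr' c z c' z' tc tz) => [<-|tcz].
  by case: ifP => _ /=; rewrite ?tc ?tz; congr (_ :: _); apply: IHs.
(* Here [c] and [z] share a class: however the two passes branch, a letter of that class is written
   and another one is carried on. *)
have IH a a' : t a = t c -> t a' = t c ->
    map t (pass r a s) = map t (pass r' a' s').
  by move=> ta ta'; apply: IHs; rewrite // ta ta'.
by do 2![case: ifP => _ /=]; rewrite -?tc -?tz -?tcz;
  congr (_ :: _); apply: IH; rewrite // -?tc -?tz -?tcz.
Qed.

Lemma map_iter_step (K : Type) (t : T -> K) r r' w k :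
  (forall a b a' b', t a = t a' -> t b = t b' ->
     r a b = r' a' b' \/ t a = t b) ->
  map t (iter k (step r) w) = map t (iter k (step r') w).
Proof.
move=> rr'; elim: k => //= k.
case: (iter _ _ _) => [|c s]; case: (iter _ _ _) => [|c' s'] //= [tc ts].
exact: map_pass.
Qed.

Lemma iter_step_equivariant r (g : T -> T) w k :
  (forall a b, r (g a) (g b) = r a b) ->
  iter k (step r) (map g w) = map g (iter k (step r) w).
Proof.
move=> rg; elim: k => //= k ->; case: (iter _ _ _) => //= c s.
by elim: s c => //= z s IHs c; rewrite rg; case: ifP => _; rewrite IHs.
Qed.

End Pass.

(** * Promotion as a pass *)

Section Promotion.
Variables (d : Order.disp_t) (P : finPOrderType d).
Implicit Types (L : P -> nat) (w p s : seq P) (x y z c : P).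

Local Notation lt := (@Order.lt d P).

Definition spelled_by L w :=
  [/\ uniq w, forall y, y \in w & forall y, L y = index y w].

Lemma spelled_by_size L w : spelled_by L w -> size w = #|P|.
Proof.
by case=> /card_uniqP <- inw _; apply: eq_card => y; rewrite inw.
Qed.

Lemma lsucc_some L w p z s y : spelled_by L w -> w = p ++ z :: s ->
  all (fun a => ~~ (y < a)%O) p -> (y < z)%O -> lsucc L y = Some z.
Proof.
move=> [_ inw Lw] wE /allP p_low yz.
have after a : (y < a)%O -> L a = size p + index a (z :: s).
  by move=> ya; rewrite Lw wE index_cat ifN //; apply/negP => /p_low /negP.
rewrite /lsucc; case: pickP => [t /andP [yt /forallP /(_ z)]|/(_ z)].
  rewrite yz !after //= eqxx leq_add2l eq_sym.
  by case: eqP => // ->.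
rewrite yz /= => /negbT /forallPn [a]; rewrite negb_imply => /andP [ya].
by rewrite !after //= eqxx addn0 leq_addr.
Qed.

Lemma lsucc_none L y : (forall a, ~~ (y < a)%O) -> lsucc L y = None.
Proof. by move=> ymax; rewrite /lsucc; case: pickP => // z; rewrite (negPf (ymax z)). Qed.

Fixpoint carriers c s :=
  if s is z :: s' then if (c < z)%O then c :: carriers z s' else carriers c s'
  else [:: c].

Lemma mem_carriers c s : {subset carriers c s <= c :: s}.
Proof.
elim: s c => [|z s IHs] c //=; case: ifP => _ a.
  by rewrite in_cons => /predU1P [->|/IHs az]; rewrite inE ?eqxx // az orbT.
by move=> /IHs; rewrite !inE => /orP [->|->]; rewrite ?orbT.
Qed.

Lemma not_above_rcons p z c y : all (fun a => ~~ (c < a)%O) p -> ~~ (y < z)%O ->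
  (forall a, (y < a)%O -> (c < a)%O) -> all (fun a => ~~ (y < a)%O) (rcons p z).
Proof.
move=> /allP cp yz yc; rewrite all_rcons yz /=; apply/allP => a /cp.
exact/contra/yc.
Qed.

(** Invariant: the prefix [p] already read has no letter above [c], so the successor of [c] is the
    next letter it is exchanged with. The fuel [k] only has to cover the unread letters. *)
Lemma chain_fromE L w k c p s : spelled_by L w -> w = p ++ s ->
  all (fun a => ~~ (c < a)%O) p -> size s <= k ->
  chain_from L k c = carriers c s.
Proof.
move=> Lw; elim: s k c p => [|z s IHs] k c p wE cp sk.
  have cmax a : ~~ (c < a)%O.
    by case: Lw => _ /(_ a); rewrite wE cats0 => /(allP cp).
  by case: k {sk} => //= k; rewrite lsucc_none.
rewrite /=; case: ifP => cz; last first.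
  apply: IHs (ltnW sk); first by rewrite wE -cat_rcons.
  by apply: not_above_rcons cp _ _; rewrite ?cz.
case: k sk => //= k sk; rewrite (lsucc_some Lw wE cp cz).
congr (_ :: _); apply: IHs sk; first by rewrite wE -cat_rcons.
by apply: not_above_rcons cp _ _ => [|a]; [rewrite ltxx | apply: lt_trans].
Qed.

(** With [p] read, [(size p).-1] letters are written, so the left side is the position of [y] in the
    new word. A carrier lands just left of the old place of its successor, the last carrier at the
    end, any other letter one place further left. *)
Lemma index_pass_carriers L w c p s y : spelled_by L w -> w = p ++ s ->
  c \in p -> all (fun a => ~~ (c < a)%O) p -> y \in c :: s ->
  (size p).-1 + index y (pass lt c s) =
  if y \in carriers c s then
    if lsucc L y is Some z then (L z).-1 else #|P|.-1
  else (L y).-1.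
Proof.
move=> Lw; elim: s c p => [|z s IHs] c p wE cInp cp.
  rewrite inE => /eqP ->; rewrite /= !eqxx addn0.
  have cmax a : ~~ (c < a)%O.
    by case: Lw => _ /(_ a); rewrite wE cats0 => /(allP cp).
  by rewrite lsucc_none // -(spelled_by_size Lw) wE cats0.
have [Uw inw Lidx] := Lw.
have p_gt0 : 0 < size p by case: p cInp {wE cp}.
have wE' : w = rcons p z ++ s by rewrite wE -cat_rcons.
have := Uw; rewrite wE cat_uniq => /and3P [Up /hasPn ps /= /andP [zs Us]].
have cNzs : c \notin z :: s by apply/negP => /ps /negP.
have Lz : L z = size p.
  by rewrite Lidx wE index_cat ifN ?ps ?mem_head //= eqxx addn0.
rewrite [pass _ _ _]/= [carriers _ _]/=; case: ifP => cz yin.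
  rewrite inE /= eq_sym; case: (altP (y =P c)) => [->|yc] /=.
    by rewrite (lsucc_some Lw wE cp cz) Lz addn0.
  rewrite -(IHs z (rcons p z)) //.
  - by rewrite size_rcons /= addnS -addSn prednK.
  - by rewrite mem_rcons mem_head.
  - apply: not_above_rcons cp _ _ => [|a]; first by rewrite ltxx.
    exact: lt_trans.
  by move: yin; rewrite inE (negPf yc).
rewrite /= eq_sym; case: (altP (y =P z)) => [->|yz] /=.
  rewrite ifN ?Lz ?addn0 //; apply/negP => /mem_carriers.
  by rewrite inE (negPf zs) orbF => /eqP zc; rewrite zc mem_head in cNzs.
rewrite -(IHs c (rcons p z)) //.
- by rewrite size_rcons /= addnS -addSn prednK.
- by rewrite mem_rcons inE cInp orbT.
- by apply: not_above_rcons cp _ _; rewrite ?cz.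
by move: yin; rewrite !inE (negPf yz).
Qed.

Lemma promotion_step L w :
  spelled_by L w -> spelled_by (promotion L) (step lt w).
Proof.
case: w => [|c s] Lw.
  by split=> // y; have [_ /(_ y)] := Lw.
have [Uw inw Lidx] := Lw.
have memP := perm_mem (perm_pass lt c s).
split=> [|y|y]; rewrite /= ?(perm_uniq (perm_pass lt c s)) ?memP //.
have chainE : promotion_chain L = carriers c s.
  rewrite /promotion_chain; case: pickP => [x|/(_ c)]; rewrite Lidx /= ?eqxx //.
  case: (c =P x) => // <- _; apply: (chain_fromE Lw (p := [:: c])) => //=.
    by rewrite ltxx.
  by rewrite -(spelled_by_size Lw) leqnSn.
rewrite /promotion chainE -(index_pass_carriers Lw (p := [:: c])) //=.
  by rewrite mem_head.
by rewrite ltxx.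
Qed.

Lemma iter_promotion_step L w k :
  spelled_by L w -> spelled_by (iter k (@promotion d P) L) (iter k (step lt) w).
Proof. by move=> Lw; elim: k => //= k; apply: promotion_step. Qed.

Lemma is_linext_spelled L w :
  spelled_by L w -> is_linext L = pairwise (not_above lt) w.
Proof.
move=> [Uw inw Lw]; apply/idP/idP => [/forallP Lx|].
  case: w Uw inw Lw => // x0 w Uw inw Lw; apply/(pairwiseP x0) => i j iw jw ij.
  apply/negP => ji; have /forallP /(_ (nth x0 (x0 :: w) i)) := Lx (nth x0 (x0 :: w) j).
  by rewrite ji !Lw !index_uniq //= ltnNge (ltnW ij).
move=> pw; apply/forallP => x; apply/forallP => y; apply/implyP => xy.
rewrite !Lw ltnNge leq_eqVlt; apply/norP; split.
  apply/eqP => E; have yx : y = x by rewrite -(nth_index x (inw y)) E nth_index.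
  by rewrite yx ltxx in xy.
apply/negP => yx; have /(pairwiseP x) := pw.
move=> /(_ (index y w) (index x w)); rewrite !inE !index_mem !nth_index ?inw //.
by move=> /(_ isT isT yx); rewrite /not_above xy.
Qed.

End Promotion.

(* The same cardinal or size can occur with several elaborations of the coercion from
   the poset to its carrier, which [lia] would treat as distinct atoms. *)
Ltac card_lia P :=
  let n := fresh "n" in
  pose n := #|P|;
  repeat match goal with
  | H : is_true (leq ?a ?b) |- _ =>
    match type of H with context [@card.body ?F ?A] =>
      change (@card.body F A) with n in H end
  | H : @eq nat ?a ?b |- _ =>
    match type of H with context [@card.body ?F ?A] =>
      change (@card.body F A) with n in H end
  | |- context [@card.body ?F ?A] => change (@card.body F A) with n
  | H : context [@size (Equality.sort ?E) ?s] |- _ =>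
    change (@size (Equality.sort E) s) with (@size P s) in H
  | |- context [@size (Equality.sort ?E) ?s] =>
    change (@size (Equality.sort E) s) with (@size P s)
  end;
  lia.

(** * Tangled labelings and survivors *)

Lemma card_fibers (I J : finType) (X : {set I}) (f : I -> J) (A : {set J}) :
  #|[set i in X | f i \in A]| = \sum_(j in A) #|[set i in X | f i == j]|.
Proof.
rewrite -sum1_card (partition_big f (mem A)) /= => [|i]; last first.
  by rewrite inE => /andP [].
apply: eq_bigr => j jA; rewrite -sum1_card; apply: eq_bigl => i.
by rewrite !inE -andbA; case: eqP => [->|_]; rewrite ?jA ?andbF ?andbT.
Qed.

Section Survivor.
Variables (d : Order.disp_t) (P : finPOrderType d).
Hypothesis P_gt1 : 1 < #|P|.
Implicit Types (L : {ffun P -> 'I_#|P|}) (x y z : P) (r : rel P).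

Local Notation lt := (@Order.lt d P).
Local Notation nat_lab L := (fun z => nat_of_ord (L z)).

Definition word L : seq P := sort (relpre L (fun i j : 'I_#|P| => i <= j)) (enum P).

Lemma spelled_by_inj L w1 w2 :
  spelled_by (nat_lab L) w1 -> spelled_by (nat_lab L) w2 -> w1 = w2.
Proof.
move=> S1 S2; have sz := (spelled_by_size S1, spelled_by_size S2).
case: S1 S2 => [U1 in1 L1] [U2 in2 L2].
have /card_gt0P [x0 _] := ltnW P_gt1.
apply: (@eq_from_nth _ x0) => [|i iw]; first by rewrite !sz.
by rewrite -(nth_index x0 (in2 (nth x0 w1 i))) -L2 L1 index_uniq.
Qed.

Lemma word_spelled L : injective L -> spelled_by (nat_lab L) (word L).
Proof.
move=> injL; have perm_w : perm_eq (word L) (enum P) by rewrite perm_sort.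
have Uw : uniq (word L) by rewrite (perm_uniq perm_w) enum_uniq.
have inw y : y \in word L by rewrite (perm_mem perm_w) mem_enum.
have inj_nat : injective (nat_lab L) by move=> a b /val_inj /injL.
(* The labels along the word increase, are distinct and exhaust the numbers below [#|P|]. *)
split=> // y; suff E : map (nat_lab L) (word L) = iota 0 #|P|.
  have sz : size (word L) = #|P| by rewrite (perm_size perm_w) -cardE.
  have iy : index y (word L) < #|P| by rewrite -sz index_mem.
  transitivity (nth 0 (map (nat_lab L) (word L)) (index y (word L))).
    by rewrite (nth_map y) ?sz // nth_index.
  by rewrite E nth_iota.
apply: (@sorted_eq _ leq leq_trans anti_leq); rewrite ?iota_sorted //.
  rewrite sorted_map; apply: sort_sorted => a b; exact: leq_total.
apply: uniq_perm; rewrite ?iota_uniq ?map_inj_uniq // => i.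
suff [_ ->] : (size (map (nat_lab L) (word L)) = size (iota 0 #|P|)) *
  (map (nat_lab L) (word L) =i iota 0 #|P|) by [].
apply: uniq_min_size; first by rewrite map_inj_uniq.
  by move=> _ /mapP [z _ ->]; rewrite mem_iota ltn_ord.
by rewrite size_iota size_map (perm_size perm_w) -cardE.
Qed.

Definition late r L := iter #|P|.-2 (step r) (word L).

Definition survivor r x L := head x (late r L).

Lemma size_stage r L k : size (iter k (step r) (word L)) = #|P|.
Proof.
rewrite (perm_size (perm_iter_step _ _ _)) /word.
by rewrite size_sort -cardE.
Qed.

(** Each pass moves the minimal letter [x] one place left, so n - 2 passes take it from position n -
    1 to position 1. *)
Lemma late_at_last r L x : injective L -> (forall z, ~~ r z x) ->
  L x = #|P|.-1 :> nat -> exists u, late r L = survivor r x L :: x :: u.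
Proof.
move=> injL xmin Lx; have [Uw inw Lw] := word_spelled injL.
have := index_iter_step (k := #|P|.-2) xmin Uw (inw x).
rewrite -Lw Lx => /(_ ltac:(card_lia P)).
have := perm_mem (perm_iter_step r (word L) #|P|.-2) x; rewrite inw.
rewrite /survivor -/(late r L).
case: (late r L) => [|y [|x' u]] //=.
  by rewrite inE => /eqP ->; rewrite eqxx /= => ?; exfalso; card_lia P.
move=> _; case: eqP => _; first by move=> ?; exfalso; card_lia P.
by case: eqP => [->|_] ?; [exists u | exfalso; card_lia P].
Qed.

Lemma survivor_neq r L x : injective L -> (forall z, ~~ r z x) ->
  L x = #|P|.-1 :> nat -> survivor r x L != x.
Proof.
move=> injL xmin Lx; have [u uE] := late_at_last injL xmin Lx.
have [Uw _ _] := word_spelled injL.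
have := perm_uniq (perm_iter_step r (word L) #|P|.-2).
by rewrite -/(late r L) uE Uw /= inE negb_or -andbA => /and3P [].
Qed.

Lemma frozen_stage L k : k < #|P| ->
  frozen lt (#|P| - k) (iter k (step lt) (word L)).
Proof.
elim: k => [|k IHk] k_lt.
  by rewrite subn0 /frozen drop_oversize ?size_stage // allrel0r.
have := IHk (ltnW k_lt); rewrite iterS.
have := size_stage lt L k; case: (iter _ _ _) => [|c s] /= sz; first by exfalso; card_lia P.
have -> : #|P| - k = (#|P| - k.+1).+1 by card_lia P.
by apply: (frozen_pass (@ltxx _ _) (@lt_trans _ _)); card_lia P.
Qed.

Lemma late_frozen L : frozen lt 2 (late lt L).
Proof.
have -> : 2 = #|P| - #|P|.-2 by card_lia P.
by apply: frozen_stage; card_lia P.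
Qed.

(** All letters from the third on are frozen, so the only possible inversion is [y] above [x], and
    one more pass always sorts. *)
Lemma tangled_late L y x u : injective L -> late lt L = y :: x :: u ->
  tangled_fun (nat_lab L) = (x < y)%O.
Proof.
move=> injL lateE; have Sw := word_spelled injL.
have linE k : is_linext (iter k (@promotion d P) (nat_lab L)) =
    pairwise (not_above lt) (iter k (step lt) (word L)).
  exact/is_linext_spelled/iter_promotion_step.
have late_lin : pairwise (not_above lt) (late lt L) = ~~ (x < y)%O.
  have := late_frozen L; rewrite lateE /frozen /= drop0 take0 => /andP [].
  by rewrite allrel_consl allrel_consl => /and3P [-> -> _] ->; rewrite !andbT.
(* Sortedness persists, so a word unsorted after n - 2 passes was unsorted at every earlier
   stage. *)
have mono k j : pairwise (not_above lt) (iter k (step lt) (word L)) ->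
    pairwise (not_above lt) (iter (j + k) (step lt) (word L)).
  move=> pk; elim: j => //= j; case: (iter _ _ _) => // c s; exact: pass_sorted.
rewrite /tangled_fun linE; have -> : pairwise (not_above lt) (iter #|P|.-1 (step lt) (word L)).
  have := @frozen_stage L #|P|.-1; have -> : #|P| - #|P|.-1 = 1 by card_lia P.
  move=> /(_ ltac:(card_lia P)); case: (iter _ _ _) => // c s.
  by rewrite /frozen /= drop0 take0 allrel1l => /andP [-> ->].
apply/forallP/idP => [H|xy k].
  have lt2 : #|P|.-2 < #|P|.-1 by card_lia P.
  by have := H (Ordinal lt2); rewrite linE /= -/(late lt L) late_lin negbK.
rewrite linE; apply/negP => /(mono _ (#|P|.-2 - k)).
have -> : #|P|.-2 - k + k = #|P|.-2 by case: k => k /= k_lt; card_lia P.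
by rewrite -/(late lt L) late_lin xy.
Qed.

Lemma tangled_min L x : injective L -> (forall z, ~~ (z < x)%O) ->
  L x = #|P|.-1 :> nat -> tangled_fun (nat_lab L) = (x < survivor lt x L)%O.
Proof.
move=> injL xmin Lx; have [u uE] := late_at_last injL xmin Lx.
exact: tangled_late uE.
Qed.

Lemma survivor_min L x z : injective L -> (forall z, ~~ (z < x)%O) ->
  L x = #|P|.-1 :> nat -> z != x -> ~~ (z < survivor lt x L)%O.
Proof.
move=> injL xmin Lx zx; have [u uE] := late_at_last injL xmin Lx.
have [_ inw _] := word_spelled injL.
have := perm_mem (perm_iter_step lt (word L) #|P|.-2) z.
have := late_frozen L; rewrite -/(late lt L) uE inw /frozen /= drop0 take0.
rewrite !inE (negPf zx) => /andP [/allrelP A _] /predU1P [->|zu].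
  by rewrite ltxx.
by apply: A; rewrite ?mem_head.
Qed.

(* As long as the last unfrozen letter has not changed it is the letter that
   was labelled [#|P|.-1]; once it changes, no unfrozen letter is above it. *)
Lemma tangled_last L : injective L -> tangled_fun (nat_lab L) ->
  exists2 x, forall z, ~~ (z < x)%O & L x = #|P|.-1 :> nat.
Proof.
move=> injL; have [Uw inw Lw] := word_spelled injL.
have /card_gt0P [x0 _] := ltnW P_gt1.
have inv k : k < #|P| -> let w := iter k (step lt) (word L) in
    nth x0 w (#|P|.-1 - k) = nth x0 (word L) #|P|.-1 \/ top lt x0 (#|P|.-1 - k) w.
  elim: k => [|k IHk] k_lt; first by left; rewrite subn0.
  have := IHk (ltnW k_lt); rewrite iterS.
  have := size_stage lt L k; case: (iter _ _ _) => [|c s] /= sz; first by exfalso; card_lia P.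
  have -> : #|P|.-1 - k = (#|P|.-1 - k.+1).+1 by card_lia P.
  have [|same topS] := top_pass (r := lt) (@ltxx _ _)
    (@lt_trans _ _) x0 (m := #|P|.-1 - k.+1) (s := s) c.
    by move: sz => /=; card_lia P.
  move=> /= [E|/topS]; last by right.
  by case: same => [->|]; [left | right].
have := size_stage lt L #|P|.-2; have := late_frozen L.
have := inv #|P|.-2 ltac:(card_lia P); rewrite /= -/(late lt L).
have -> : #|P|.-1 - #|P|.-2 = 1 by card_lia P.
have := perm_mem (perm_iter_step lt (word L) #|P|.-2); rewrite -/(late lt L).
case E : (late lt L) => [|y [|x u]]; rewrite /= => memE; try card_lia P.
move=> xlast fr _; rewrite (tangled_late injL E) => xy.
exists x => [z|].
  have := memE z; rewrite inw !inE => /or3P [/eqP ->|/eqP ->|zu].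
  - by apply/negP => /(lt_trans xy); rewrite ltxx.
  - by rewrite ltxx.
  move: fr; rewrite /frozen /= drop0 take0 => /andP [/allrelP A _].
  by apply: A; rewrite // !inE eqxx orbT.
(* The alternative [top] would forbid [x < y]. *)
case: xlast => [->|]; last by rewrite /top /= xy.
by rewrite Lw index_uniq // (spelled_by_size (word_spelled injL)); card_lia P.
Qed.

(** * Labelings with a prescribed last element *)

Definition labelings_last x : {set {ffun P -> 'I_#|P|}} :=
  [set L : {ffun P -> 'I_#|P|} | injectiveb L && (L x == #|P|.-1 :> nat)].

(** Exchanging two labels is injective, so the n possible labels of [x] share the n! labelings
    equally. *)
Lemma card_labelings_last x : #|labelings_last x| = (#|P|.-1)`!.
Proof.
pose M (i : 'I_#|P|) :=
    #|[set L : {ffun P -> 'I_#|P|} in [set f : {ffun P -> 'I_#|P|} | injectiveb f] | L x == i]|.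
have le_M i j : M i <= M j.
  pose h (L : {ffun P -> 'I_#|P|}) := [ffun z => tperm i j (L z)].
  have h_inj : injective h.
    by move=> L1 L2 /ffunP E; apply/ffunP => z; have := E z; rewrite !ffunE => /perm_inj.
  rewrite /M -(card_imset _ h_inj); apply/subset_leq_card/subsetP => _ /imsetP [L + ->].
  rewrite !inE ffunE => /andP [/injectiveP injL /eqP ->]; rewrite tpermL eqxx andbT.
  by apply/injectiveP => a b; rewrite !ffunE => /perm_inj /injL.
have lt_last : #|P|.-1 < #|P| by card_lia P.
have -> : #|labelings_last x| = M (Ordinal lt_last).
  by apply: eq_card => L; rewrite !inE -val_eqE.
have := card_inj_ffuns P 'I_#|P|; rewrite card_ord ffactnn.
have -> : #|[set f : {ffun P -> 'I_#|P|} | injectiveb f]| = #|P| * M (Ordinal lt_last).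
  transitivity (\sum_(i in [set: 'I_#|P|]) M i).
    by rewrite -card_fibers; apply: eq_card => L; rewrite !inE andbT.
  rewrite (eq_bigr (fun=> M (Ordinal lt_last))); last first.
    by move=> i _; apply/eqP; rewrite eqn_leq !le_M.
  by rewrite sum_nat_const cardsT card_ord.
have P_gt0 := ltnW P_gt1.
have -> : #|P|`! = #|P| * (#|P|.-1)`! by rewrite -{1}(prednK P_gt0) factS prednK.
by move=> /eqP; rewrite eqn_pmul2l // => /eqP.
Qed.

Definition ends_in x (S : {set P}) :=
  [set L in labelings_last x | survivor lt x L \in S].

(** * Equidistribution of the survivor *)

Section Equidistribution.
Variables (S C : {set P}) (x : P).
Hypotheses (CS : C \subset S) (xmin : forall z, ~~ (z < x)%O).
Hypothesis S_lower : forall z s, s \in S -> (z < s)%O -> z \in S.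
Hypothesis S_module :
  forall z s s', z \notin S -> s \in S -> s' \in S -> (s < z)%O = (s' < z)%O.
Hypothesis C_component :
  forall a b, a \in S -> b \in S -> (a < b)%O -> (a \in C) = (b \in C).

(* The order with [S] made into an antichain: passes for [lt] and for [flat]
   move the letters of [S] through the same positions, up to exchanges inside
   [C] and inside [S :\: C], and [flat] is invariant under permuting [S]. *)
Definition flat : rel P := fun a b => (a < b)%O && ~~ ((a \in S) && (b \in S)).

Lemma flat_min z : ~~ flat z x.
Proof. by rewrite /flat negb_and xmin. Qed.

Lemma flat_tperm s s' a b : s \in S -> s' \in S ->
  flat (tperm s s' a) (tperm s s' b) = flat a b.
Proof.
move=> sS s'S; have inS z : (tperm s s' z \in S) = (z \in S).
  by case: tpermP => [->|->|]; rewrite ?sS ?s'S.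
have outS z : z \notin S -> tperm s s' z = z.
  by move=> zS; rewrite tpermD //; apply: contraNneq zS => <-.
rewrite /flat !inS; case: (boolP (b \in S)) => bS.
  case: (boolP (a \in S)) => aS; rewrite ?andbF //= outS // !andbT.
  apply/idP/idP => [/(S_lower _)|/(S_lower bS)]; last by rewrite (negPf aS).
  by rewrite inS (negPf aS) => /(_ bS).
rewrite !andbF !andbT (outS b) //; case: (boolP (a \in S)) => aS.
  by apply: S_module; rewrite ?inS.
by rewrite outS.
Qed.

(** Relabeling by the transposition permutes the letters of the word, and passes for [flat] commute
    with this. *)
Lemma survivor_tperm L s s' : injective L -> s \in S -> s' \in S ->
  s != x -> s' != x ->
  survivor flat x [ffun z => L (tperm s s' z)] = tperm s s' (survivor flat x L).
Proof.
move=> injL sS s'S sx s'x; set L' := finfun _.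
have injL' : injective L'.
  by move=> a b; rewrite !ffunE => /injL /perm_inj.
have -> : survivor flat x L' = head x (map (tperm s s') (late flat L)).
  rewrite /survivor /late -iter_step_equivariant => [|a b]; last exact: flat_tperm.
  congr (head x (iter _ _ _)); apply: (@spelled_by_inj L'); first exact: word_spelled.
  have [Uw inw Lw] := word_spelled injL.
  split=> [|y|y]; first by rewrite map_inj_uniq //; apply: perm_inj.
    by rewrite -(tpermK s s' y) mem_map //; apply: perm_inj.
  by rewrite ffunE Lw -{2}(tpermK s s' y) index_map //; apply: perm_inj.
by rewrite /survivor; case: (late flat L) => //=; rewrite tpermD.
Qed.

(** Transpositions inside [S :\ x] keep the label of [x] and permute the survivors, so all these
    elements survive equally often, while [x] never does. *)
Lemma card_survivor_flat (A : {set P}) s : A \subset S -> s \in S -> s != x ->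
  #|[set L in labelings_last x | survivor flat x L \in A]| =
  #|A :\ x| * #|[set L in labelings_last x | survivor flat x L == s]|.
Proof.
move=> AS sS sx; pose N z := #|[set L in labelings_last x | survivor flat x L == z]|.
have le_N z z' : z \in S :\ x -> z' \in S :\ x -> N z <= N z'.
  rewrite !inE => /andP [zx zS] /andP [z'x z'S].
  pose h (L : {ffun P -> 'I_#|P|}) := [ffun y => L (tperm z z' y)].
  have h_inj : injective h.
    move=> L1 L2 /ffunP E; apply/ffunP => y; have := E (tperm z z' y).
    by rewrite !ffunE tpermK.
  rewrite /N -(card_imset _ h_inj); apply/subset_leq_card/subsetP => _ /imsetP [L + ->].
  rewrite !inE => /andP [/andP [/injectiveP injL Lx] /eqP Lz].
  rewrite survivor_tperm // Lz tpermL eqxx ffunE tpermD // Lx !andbT.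
  by apply/injectiveP => a b; rewrite !ffunE => /injL /perm_inj.
transitivity (\sum_(z in A :\ x) N z).
  rewrite -card_fibers; apply: eq_card => L; rewrite !inE.
  case: (boolP (injectiveb L && _)) => //= /andP [/injectiveP injL /eqP Lx].
  by rewrite survivor_neq //; apply: flat_min.
rewrite (eq_bigr (fun=> N s)) ?sum_nat_const // => z /setD1P [zx zA].
have zSx : z \in S :\ x by rewrite !inE zx (subsetP AS).
have sSx : s \in S :\ x by rewrite !inE sx.
by apply/eqP; rewrite eqn_leq !le_N.
Qed.

Lemma survivor_flat L :
  ((survivor lt x L \in S) = (survivor flat x L \in S)) *
  ((survivor lt x L \in C) = (survivor flat x L \in C)).
Proof.
(* Letters outside [S] are remembered exactly, letters of [S] only by their membership in [C]. *)
pose t z := if z \in S then inl (z \in C) else inr z : bool + P.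
have tE z z' : t z = t z' -> ((z \in S) = (z' \in S)) * ((z \in C) = (z' \in C)).
  by rewrite /t; case: (z \in S); case: (boolP (z' \in S)) => z'S // [->].
have : map t (late lt L) = map t (late flat L).
  apply: map_iter_step => a b a' b'; rewrite /t /flat.
  case: (boolP (a \in S)) => aS; case: (boolP (a' \in S)) => a'S //.
    case: (boolP (b \in S)) => bS; case: (boolP (b' \in S)) => b'S // [aC] [bC].
      (* Only here can [lt] and [flat] differ: comparable letters of [S], which lie on the same side
         of [C]. *)
      rewrite andbF; case: (boolP (a < b)%O) => ab; last by left.
      by right; rewrite (C_component aS bS ab).
    by rewrite -bC andbT; left; apply: S_module.
  case: (boolP (b \in S)) => bS; case: (boolP (b' \in S)) => b'S // [<-].
    move=> _; left; rewrite /= andbT; apply/idP/idP.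
      by move=> /(S_lower bS); rewrite (negPf aS).
    by move=> /(S_lower b'S); rewrite (negPf aS).
  by move=> [<-]; left; rewrite andbT.
rewrite /survivor; case: (late lt L) => [|y w]; case: (late flat L) => [|y' w'] //.
by case=> /tE.
Qed.

(** The conditional probability, cross-multiplied to stay in [nat]: under [flat] each count is a
    common factor times the number of available survivors. *)
Lemma ends_in_component :
  #|ends_in x C| * #|S :\ x| = #|ends_in x S| * #|C :\ x|.
Proof.
have flatE (A : {set P}) : (forall L, (survivor lt x L \in A) = (survivor flat x L \in A)) ->
    #|ends_in x A| = #|[set L in labelings_last x | survivor flat x L \in A]|.
  by move=> AE; apply: eq_card => L; rewrite !inE AE.
rewrite !flatE; try by move=> L; rewrite survivor_flat.
case: (set_0Vmem (S :\ x)) => [Sx0|[s /setD1P [sx sS]]].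
  have -> : C :\ x = set0 by apply/eqP; rewrite -subset0 -Sx0 setSD.
  by rewrite Sx0 cards0 !muln0.
by rewrite !(card_survivor_flat (s := s)) // mulnAC [in RHS]mulnC mulnA.
Qed.

End Equidistribution.

Definition tangled_in x (S : {set P}) :=
  [set L in ends_in x S | (x < survivor lt x L)%O].

(** Minimality is in all of [P]; for a lower set [S] these are the minimal elements of [S]. *)
Definition minimals (S : {set P}) := [set x in S | [forall z, ~~ (z < x)%O]].

Lemma minimalsP (S : {set P}) x :
  reflect (x \in S /\ forall z, ~~ (z < x)%O) (x \in minimals S).
Proof. by rewrite inE; apply: (iffP andP) => -[xS /forallP]. Qed.

Lemma ends_inP x (S : {set P}) L : reflect
  [/\ injective L, L x = #|P|.-1 :> nat & survivor lt x L \in S] (L \in ends_in x S).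
Proof.
rewrite !inE; apply: (iffP andP) => [[/andP [/injectiveP ? /eqP ?] ?]|[iL Lx fS]] //.
by rewrite fS; split=> //; apply/andP; split; [apply/injectiveP | apply/eqP].
Qed.

(** * Descent along the forest *)

Section Inflation.
Variables (d' : Order.disp_t) (Q : finPOrderType d') (phi : P -> Q).
Hypotheses (forestQ : rooted_forest Q) (inflP : is_inflation phi).

Lemma cover_below (t a : Q) : (t < a)%O -> exists2 c, covers t c & (c <= a)%O.
Proof.
move=> ta; have Pa : (t < a <= a)%O by rewrite ta lexx.
(* Minimising the size of the strict down-set yields a minimal element of the interval, hence a
   cover. *)
have [c /andP [tc ca] cmin] :=
  @arg_minnP _ a (fun c => (t < c <= a)%O) (fun c => #|[set w | (w < c)%O]|) Pa.
exists c => //; split=> // -[w [tw wc]].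
have : [set v | (v < w)%O] \proper [set v | (v < c)%O].
  apply/properP; split; last by exists w; rewrite !inE ?wc ?ltxx.
  by apply/subsetP => v; rewrite !inE => /lt_trans; apply.
move=> /proper_card; rewrite ltnNge cmin // tw.
exact: ltW (lt_le_trans wc ca).
Qed.

(** Both [a] and [b] lie weakly above the unique cover of [t]; the induction is on the size of the
    strict up-set of [t]. *)
Lemma forest_above_chain (t a b : Q) :
  (t < a)%O -> (t < b)%O -> [\/ (a < b)%O, a = b | (b < a)%O].
Proof.
elim: {t}_.+1 {-2}t (ltnSn #|[set w | (t < w)%O]|) => // m IHm t le_m ta tb.
have [c tc ca] := cover_below ta; have [c' tc' cb] := cover_below tb.
rewrite -{c' tc'}(forestQ tc tc') in cb.
move: ca cb; rewrite !le_eqVlt => /predU1P [->|ca] /predU1P [E|cb].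
- by rewrite E; constructor 2.
- by constructor 1.
- by rewrite -E; constructor 3.
apply: IHm ca cb; apply: leq_trans (ltnSE le_m); apply/proper_card/properP.
have [tcl _] := tc; split; last by exists c; rewrite !inE ?tcl ?ltxx.
by apply/subsetP => v; rewrite !inE; apply: lt_trans.
Qed.

Definition blowup (T : {set Q}) := [set z | phi z \in T].

Definition lower_set (T : {set Q}) :=
  forall t q : Q, t \in T -> (q < t)%O -> q \in T.

Definition upward_module (T : {set Q}) := forall q t t' : Q,
  q \notin T -> t \in T -> t' \in T -> (t < q)%O = (t' < q)%O.

Lemma lt_inflation x y : phi x != phi y -> (x < y)%O = (phi x < phi y)%O.
Proof. by case: inflP => _ [_ H] /eqP /H E; apply/idP/idP => /E. Qed.

Lemma le_inflation x y : (x < y)%O -> (phi x <= phi y)%O.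
Proof.
move=> xy; have [->//|xNy] := eqVneq (phi x) (phi y).
by apply: ltW; rewrite -lt_inflation.
Qed.

Lemma phi_surj v : exists x, phi x = v.
Proof. by case: inflP => H _; apply: H. Qed.

Lemma fiber_minimal_unique x y : phi x = phi y ->
  (forall z, ~~ (z < x)%O) -> (forall z, ~~ (z < y)%O) -> x = y.
Proof.
move=> xy xmin ymin; case: inflP => _ [/(_ (phi x)) [m [_ m_uniq]] _].
transitivity m; [apply/esym|]; apply: m_uniq; split=> // z _; by apply/negP.
Qed.

Lemma blowup_lower T z s : lower_set T -> s \in blowup T -> (z < s)%O -> z \in blowup T.
Proof.
move=> Tlow; rewrite !inE => sT /le_inflation; rewrite le_eqVlt => /predU1P [->//|].
exact: Tlow.
Qed.

Lemma blowup_module T z s s' : upward_module T -> z \notin blowup T ->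
  s \in blowup T -> s' \in blowup T -> (s < z)%O = (s' < z)%O.
Proof.
move=> Tmod; rewrite !inE => zT sT s'T.
rewrite !lt_inflation; first exact: Tmod.
all: by apply: contraNneq zT => <-.
Qed.

(** Induction on [#|T|], by removing a greatest element of [T] or splitting [T] into two
    incomparable parts. The number [a] plays the role of (n - 1)!, its value for [T = setT]. *)
Lemma tangled_sum_bound T a : lower_set T -> upward_module T ->
  (forall x, x \in minimals (blowup T) -> #|ends_in x (blowup T)| = a) ->
  let total := \sum_(x in minimals (blowup T)) #|tangled_in x (blowup T)| in
  total <= a /\ (1 < #|minimals (blowup T)| -> 0 < a -> total < a).
Proof.
elim: {T}_.+1 {-2}T (ltnSn #|T|) a => // m IHm T le_m a Tlow Tmod Ta /=.
have [min_le1|min_gt1] := leqP #|minimals (blowup T)| 1.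
  split=> //; apply: (@leq_trans (\sum_(x in minimals (blowup T)) a)).
    apply: leq_sum => x xm; rewrite -(Ta x xm); apply/subset_leq_card/subsetP => L.
    by rewrite inE => /andP [].
  by rewrite sum_nat_const -[leqRHS]mul1n leq_mul2r min_le1 orbT.
have [x1 x1min] : exists x, x \in minimals (blowup T).
  by apply/card_gt0P/ltnW.
have phix1 : phi x1 \in T by case/minimalsP: x1min; rewrite inE.
(* A maximal element of [T]: one with the largest strict down-set. *)
have [v vT vmax] := @arg_maxnP _ (phi x1) (mem T) (fun v => #|[set w | (w < v)%O]|) phix1.
change (is_true (v \in T)) in vT.
have {}vmax t : t \in T -> ~~ (v < t)%O.
  move=> tT; apply/negP => vt; have := vmax t tT; rewrite /= leqNgt => /negP; apply.
  apply/proper_card/properP; split; last by exists v; rewrite !inE ?vt ?ltxx.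
  by apply/subsetP => w; rewrite !inE => /lt_trans; apply.
(* If [v] is the greatest element of [T], its fiber contains neither a minimal element nor a
   survivor, so removing [v] changes no count. *)
have [/subsetP Tv|TNv] := boolP (T \subset [set t | (t <= v)%O]).
  have {}Tv t : t \in T -> (t <= v)%O by move=> /Tv; rewrite inE.
  pose D := T :\ v.
  (* A second minimal element [y] would lie in the same fiber, contradicting uniqueness there, or
     below [x]. *)
  have vmin x : x \in minimals (blowup T) -> phi x != v.
    move=> /minimalsP [xT xmin]; apply/eqP => xv.
    have : 0 < #|minimals (blowup T) :\ x|.
      by move: min_gt1; rewrite (cardsD1 x); case: (_ \in _) => //; card_lia P.
    move=> /card_gt0P [y /setD1P [yx /minimalsP [yT ymin]]].
    move: yT; rewrite inE => /Tv; rewrite le_eqVlt => /predU1P [yv|yv].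
      by move/eqP: yx; apply; apply: fiber_minimal_unique; rewrite ?yv.
    have := xmin y; rewrite lt_inflation xv ?yv //.
    by rewrite (lt_eqF yv).
  have minD : minimals (blowup T) = minimals (blowup D).
    apply/setP => x; apply/idP/idP => [xm|/minimalsP [xD xmin]].
      have /minimalsP [xT xmin] := xm; apply/minimalsP; split=> //.
      by rewrite inE !inE (vmin x xm); rewrite inE in xT.
    by apply/minimalsP; split=> //; move: xD; rewrite !inE => /andP [].
  have endsD x : x \in minimals (blowup T) -> ends_in x (blowup T) = ends_in x (blowup D).
    move=> xm; have /minimalsP [_ xmin] := xm.
    apply/setP => L; apply/ends_inP/ends_inP => -[injL Lx]; rewrite !inE => fT; split=> //.
      rewrite fT andbT; apply/eqP => fv.
      (* Another minimal element [y] would lie below a survivor in the fiber of [v], against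
         [survivor_min]. *)
      have : 0 < #|minimals (blowup T) :\ x|.
        by move: min_gt1; rewrite (cardsD1 x) xm.
      move=> /card_gt0P [y /setD1P [yx ym]]; have := vmin y ym.
      have /minimalsP [yT _] := ym => yv.
      have := survivor_min injL xmin Lx yx; rewrite lt_inflation fv //.
      by rewrite lt_neqAle yv Tv //; move: yT; rewrite inE.
    by case/andP: fT.
  have -> : \sum_(x in minimals (blowup T)) #|tangled_in x (blowup T)| =
      \sum_(x in minimals (blowup T)) #|tangled_in x (blowup D)|.
    by apply: eq_bigr => x xm; rewrite /tangled_in endsD.
  rewrite minD in min_gt1 *.
  suff [le_a lt_a] :
      let total := \sum_(x in minimals (blowup D)) #|tangled_in x (blowup D)| in
      total <= a /\ (1 < #|minimals (blowup D)| -> 0 < a -> total < a).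
    by split=> // _; apply: lt_a.
  apply: IHm.
  - by move: le_m; rewrite (cardsD1 v) vT.
  - move=> t q; rewrite !inE => /andP [tv tT] qt; rewrite (Tlow t) // andbT.
    by apply: contraNneq (vmax t tT) => <-.
  - move=> q t t'; rewrite !inE negb_and negbK => /orP [/eqP ->|qT] /andP [tv tT] /andP [t'v t'T].
      by rewrite !lt_neqAle tv t'v !Tv.
    exact: Tmod.
  by move=> x; rewrite -minD => xm; rewrite -endsD // Ta.
pose part b := [set t in T | (t <= v)%O == b].
(* If [s] is below both [t] and [v], the forest makes [t] and [v] comparable, and maximality of [v]
   leaves [t <= v]. *)
have incomparable s t : s \in T -> t \in T -> (s < t)%O -> (s <= v)%O = (t <= v)%O.
  move=> sT tT st; apply/idP/idP => [|/(lt_le_trans st) /ltW //].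
  rewrite le_eqVlt => /predU1P [sv|sv].
    by have := vmax t tT; rewrite -sv st.
  case: (forest_above_chain st sv) => [/ltW //|->//|vt].
  by have := vmax t tT; rewrite vt.
have same_part b x y : x \in blowup T -> y \in blowup T -> (x < y)%O ->
    (x \in blowup (part b)) = (y \in blowup (part b)).
  rewrite !inE => xT yT xy; rewrite xT yT /=.
  have [->//|xNy] := eqVneq (phi x) (phi y).
  by rewrite (incomparable _ _ xT yT) // -lt_inflation.
have part_sub b : blowup (part b) \subset blowup T.
  by apply/subsetP => x; rewrite !inE => /andP [].
have part_neq0 b : 0 < #|part b|.
  apply/card_gt0P; case: b; first by exists v; rewrite inE vT lexx.
  by have /subsetPn [t tT] := TNv; rewrite inE => tv; exists t; rewrite inE tT (negPf tv).
have part_lt b : #|part b| < #|T|.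
  have /card_gt0P [t] := part_neq0 (~~ b); rewrite inE => /andP [tT /eqP tb].
  apply/proper_card/properP; split; last by exists t; rewrite // inE tT tb; case: (b).
  by apply/subsetP => t'; rewrite inE => /andP [].
have blowup_gt0 b : 0 < #|blowup (part b)|.
  have /card_gt0P [t tb] := part_neq0 b; have [x xt] := phi_surj t.
  by apply/card_gt0P; exists x; rewrite inE xt.
have blowup_gt1 : 1 < #|blowup T|.
  apply: leq_trans min_gt1 _; apply/subset_leq_card/subsetP => x.
  by case/minimalsP.
pose total b := \sum_(x in minimals (blowup (part b))) #|tangled_in x (blowup (part b))|.
have total_bound b : total b * #|blowup T|.-1 <= a * #|blowup (part b)|.-1.
  (* The induction hypothesis is used with the quotient as its [a]; [ends_in_component] shows that
     the division is exact. *)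
  apply: leq_trans (leq_divM _ #|blowup T|.-1); rewrite leq_mul2r; apply/orP; right.
  apply: (proj1 (IHm (part b) _ _ _ _ _)).
  - exact: leq_trans (part_lt b) (ltnSE le_m).
  - move=> t q; rewrite !inE => /andP [tT /eqP <-] qt; have qT := Tlow t q tT qt.
    by rewrite qT (incomparable q t) ?eqxx.
  - move=> q t t'; rewrite !inE => + /andP [tT /eqP tb] /andP [t'T /eqP t'b].
    have [qT /= qb|qT _] := boolP (q \in T); last exact: Tmod.
    have no_lt s : s \in T -> (s <= v)%O = b -> (s < q)%O = false.
      move=> sT sb; apply/negP => /(incomparable s q sT qT).
      by rewrite sb => E; rewrite -E eqxx in qb.
    by rewrite !no_lt.
  move=> x /minimalsP [xb xmin]; have xT := subsetP (part_sub b) x xb.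
  have xm : x \in minimals (blowup T) by apply/minimalsP.
  have := ends_in_component (part_sub b) xmin (fun z s => @blowup_lower T z s Tlow)
    (fun z s s' => @blowup_module T z s s' Tmod) (same_part b).
  have cardD1 (A : {set P}) : x \in A -> #|A :\ x| = #|A|.-1.
    by move=> xA; rewrite [in RHS](cardsD1 x) xA.
  rewrite !cardD1 // (Ta x xm) => <-; rewrite mulnK //.
  by case: #|_| blowup_gt1 => [|[]].
(* A survivor above [x] lies in the same part as [x]. *)
have tangled_part b x : x \in minimals (blowup (part b)) ->
    tangled_in x (blowup T) = tangled_in x (blowup (part b)).
  move=> /minimalsP [xb _]; apply/setP => L.
  apply/setIdP/setIdP => -[/ends_inP [injL Lx fT] xf]; split=> //; apply/ends_inP; split=> //.
    by rewrite -(same_part b x) // (subsetP (part_sub b)).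
  exact: subsetP (part_sub b) _ fT.
have splitS : \sum_(x in minimals (blowup T)) #|tangled_in x (blowup T)| =
    total true + total false.
  rewrite (big_setID (blowup (part true))) /=; congr (_ + _).
    apply: eq_big => [x|x]; last move=> /setIP [/minimalsP [_ xmin] xT].
      by rewrite !inE; case: (phi x \in T); rewrite ?andbF //= eqb_id andbC.
    by rewrite (tangled_part true) //; apply/minimalsP.
  have partE x : (x \in minimals (blowup T) :\: blowup (part true)) =
      (x \in minimals (blowup (part false))).
    by rewrite !inE; case: (phi x \in T); case: (_ <= _)%O.
  by apply: eq_big => // x; rewrite partE => xm; rewrite (tangled_part false).
have card_split : #|blowup T| = #|blowup (part true)| + #|blowup (part false)|.
  rewrite -(cardsID (blowup (part true))); congr (_ + _); apply: eq_card => x.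
    by rewrite !inE; case: (_ \in T).
  by rewrite !inE; case: (_ \in T); case: (_ <= _)%O.
rewrite splitS.
move: (total_bound true) (total_bound false) (blowup_gt0 true) (blowup_gt0 false) card_split.
move: #|blowup T| #|blowup (part true)| #|blowup (part false)| (total true) (total false).
move=> s s1 s2 t1 t2 b1 b2 s1_gt0 s2_gt0 sE.
(* Adding the two bounds gives (s1 - 1) + (s2 - 1) = s - 2 against s - 1, the source of the strict
   loss. *)
have {b1 b2} : (t1 + t2) * s.-2.+1 <= a * s.-2.
  have -> : s.-2.+1 = s.-1 by lia.
  have -> : s.-2 = s1.-1 + s2.-1 by lia.
  by rewrite mulnDl mulnDr leq_add.
move: s.-2 => k bound; split=> [|_ a_gt0].
  by rewrite -(leq_pmul2r (ltn0Sn k)) (leq_trans bound) // leq_mul2l leqnSn orbT.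
by rewrite -(ltn_pmul2r (ltn0Sn k)) (leq_ltn_trans bound) // ltn_pmul2l.
Qed.

End Inflation.

(** * Summing over the minimal elements *)

Lemma minimal_below y : exists2 x, x \in minimals setT & (x <= y)%O.
Proof.
have [x xy xmin] := @arg_minnP _ y (fun x => (x <= y)%O)
  (fun x => #|[set w | (w < x)%O]|) (lexx y).
exists x => //; apply/minimalsP; split=> // z; apply/negP => zx.
have : [set w | (w < z)%O] \proper [set w | (w < x)%O].
  apply/properP; split; last by exists z; rewrite !inE ?zx ?ltxx.
  by apply/subsetP => w; rewrite !inE => /lt_trans; apply.
by move=> /proper_card; rewrite ltnNge xmin // ltW // (lt_le_trans zx).
Qed.

Lemma unique_minimalP : unique_minimal P <-> #|minimals setT| = 1.
Proof.
split=> [[m [mmin m_uniq]]|/eqP /cards1P [m mE]].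
  apply/eqP/cards1P; exists m; apply/setP => x; rewrite inE.
  apply/minimalsP/eqP => [[_ xmin]|->]; last by split=> // z; apply/negP.
  by apply/esym/m_uniq => z; apply/negP.
have /minimalsP [_ mmin] : m \in minimals setT by rewrite mE set11.
exists m; split=> [x|x xmin]; first exact/negP.
apply/esym/set1P; rewrite -mE; apply/minimalsP; split=> // z; exact/negP.
Qed.

(** A tangled labeling has its largest label at a minimal element, and by injectivity at only one,
    so it is counted once. *)
Lemma card_tangled_sum :
  #|tangled_labelings P| = \sum_(x in minimals setT) #|tangled_in x setT|.
Proof.
have tangledE L x : x \in minimals setT -> L x = #|P|.-1 :> nat ->
    (L \in tangled_in x setT) = (L \in tangled_labelings P).
  move=> /minimalsP [_ xmin] Lx; rewrite /tangled_in /ends_in !in_set andbT Lx eqxx andbT.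
  rewrite /is_tangled_labeling /is_labeling; case: injectiveP => //= injL.
  by rewrite (tangled_min injL xmin Lx).
transitivity (\sum_(x in minimals setT) \sum_L (L \in tangled_in x setT : nat)).
  rewrite exchange_big /= -sum1_card big_mkcond /=; apply: eq_bigr => L _.
  have [Lt|LNt] := boolP (L \in tangled_labelings P).
    have := Lt; rewrite inE => /andP [/injectiveP injL /(tangled_last injL) [x xmin Lx]].
    have xm : x \in minimals setT by apply/minimalsP.
    rewrite (bigD1 x) //= tangledE // Lt big1 // => y /andP [ym yx].
    apply/eqP; rewrite eqb0; apply/negP => /setIdP [/ends_inP [_ Ly _] _].
    by case/eqP: yx; apply/injL/val_inj; rewrite /= Lx Ly.
  rewrite big1 // => x xm; apply/eqP; rewrite eqb0; apply: contra LNt => Lt.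
  by rewrite -(tangledE L x) //; case/setIdP: Lt => /ends_inP [].
by apply: eq_bigr => x _; rewrite -sum1_card [RHS]big_mkcond; apply: eq_bigr => L _; case: (_ \in _).
Qed.

Lemma ends_in_setT x : ends_in x setT = labelings_last x.
Proof. by apply/setP => L; rewrite in_set in_setT andbT. Qed.

Lemma tangled_bound : inflated_rooted_forest P ->
  #|tangled_labelings P| <= (#|P|.-1)`! /\
  (#|tangled_labelings P| = (#|P|.-1)`! <-> unique_minimal P).
Proof.
case=> d' [Q [phi [forestQ inflP]]].
have blowupT : blowup phi setT = setT by apply/setP => x; rewrite !inE.
have := @tangled_sum_bound _ Q phi forestQ inflP setT (#|P|.-1)`!.
rewrite blowupT -card_tangled_sum => -[||x _|le_fact lt_fact].
- by move=> t q _ _; rewrite in_setT.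
- by move=> q t t'; rewrite in_setT.
- by rewrite ends_in_setT card_labelings_last.
split=> //; rewrite unique_minimalP; split=> [E|m1].
  apply/eqP; rewrite eqn_leq; apply/andP; split.
    by rewrite leqNgt; apply/negP => /lt_fact; rewrite fact_gt0 E ltnn => /(_ isT).
  have /card_gt0P [y _] := ltnW P_gt1; have [x xm _] := minimal_below y.
  by apply/card_gt0P; exists x.
have /eqP/cards1P [m mE] := m1; have /minimalsP [_ mmin] : m \in minimals setT by rewrite mE set11.
(* With [m] the only minimal element, a survivor differs from [m] and so lies above it: every
   labeling with [m] last is tangled. *)
rewrite card_tangled_sum mE big_set1 -(card_labelings_last m).
apply: eq_card => L; rewrite -ends_in_setT in_set.
case: (boolP (L \in ends_in m setT)) => //= /ends_inP [injL Lm _].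
have := survivor_neq injL (r := lt) mmin Lm; have [x] := minimal_below (survivor lt m L).
by rewrite mE => /set1P ->; rewrite le_eqVlt eq_sym => /orP [->|->].
Qed.

End Survivor.

(** One element is treated apart, since n - 2 passes presuppose n > 1. The only labeling is a linear
    extension, with sorting time n - 1 = 0. *)
Lemma tangled_card1 (d : Order.disp_t) (P : finPOrderType d) : #|P| = 1 ->
  #|tangled_labelings P| = 1 /\ unique_minimal P.
Proof.
move=> P1; have eqP1 (x y : P) : x = y.
  by apply: (@card_le1_eqP _ P _) => //; rewrite P1.
split.
  transitivity #|{ffun P -> 'I_#|P|}|; last by rewrite card_ffun card_ord P1.
  apply: eq_card => L; rewrite !inE.
  apply/andP; split; first by apply/injectiveP => x y _.
  apply/andP; split; last by apply/forallP => -[k k_lt]; exfalso; rewrite P1 in k_lt.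
  apply/forallP => x; apply/forallP => y; rewrite (eqP1 x y) ltxx //.
have /card_gt0P [x _] : 0 < #|P| by rewrite P1.
by exists x; split=> [y|y _]; rewrite (eqP1 y x) ?ltxx.
Qed.

Theorem mainTheorem12 (d : Order.disp_t) (P : finPOrderType d) :
  (0 < #|P|)%N ->
  inflated_rooted_forest P ->
  (#|tangled_labelings P| <= (#|P| - 1)`!)%N /\
  (#|tangled_labelings P| = (#|P| - 1)`! <-> unique_minimal P).
Proof.
rewrite subn1 leq_eqVlt => /predU1P [P1 _|]; last exact: tangled_bound.
have [tangled1 umin] := tangled_card1 (esym P1).
by rewrite tangled1 -P1.
Qed.
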